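(* Let $(A,\mathbf{B},\delta)$ be a non-homogeneous $C$-algebra arising from an Allen matrix $s$ of rank $5$, with standard basis $\mathbf{B}=\{b_0,b_1,\dots,b_4\}$. Then $s$ is not an integral Fourier matrix. In other words, there is no $C$-algebra of rank $5$ arising from an integral Fourier matrix.
   Context: Fourier and Allen matrices: rows and columns of $r\times r$ matrices are indexed by $0,1,\dots,r-1$. A Fourier matrix of rank $r$ is a complex $r\times r$ matrix $S$ that is unitary and symmetric, has $S_{i0}>0$ for all $i$, and satisfies $N_{ijk}=\sum_l S_{li}S_{lj}\overline{S_{lk}}\,S_{l0}^{-1}\in\mathbb{Z}$ for all $i,j,k$. The associated Allen matrix is $s=[s_{ij}]$ with $s_{ij}=S_{ij}/S_{i0}$. $C$-algebra arising from $s$: put $P=[p_{ij}]$ with $p_{ij}=s_{ij}s_{0j}$, let $b_j\in\mathbb{C}^r$ be the $j$-th column of $P$, $\mathbf{B}=\{b_0,\dots,b_{r-1}\}$, and let $A$ be the $\mathbb{C}$-span of $\mathbf{B}$ with componentwise multiplication, whose identity is $b_0$. The involution on $A$ is entrywise complex conjugation, and it maps $\mathbf{B}$ to itself. The degree map $\delta:A\to\mathbb{C}$ is the algebra homomorphism giving the $0$-th coordinate, so $\delta(b_j)=p_{0j}=s_{0j}^2>0$. The triple $(A,\mathbf{B},\delta)$ is the $C$-algebra arising from the Allen matrix $s$; $\mathbf{B}$ is its standard basis, $r$ its rank. It is called homogeneous if there is $k\in\mathbb{Z}^+$ with $\delta(b_i)=k$ for all $1\le i\le r-1$, and non-homogeneous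 otherwise. Integral Fourier matrix: an $r\times r$ matrix $s$ with integer entries such that (1) $s_{i0}=1$ for all $i$ and $\det s\ne0$; (2) $ss^T=\mathrm{diag}(d_0,\dots,d_{r-1})$ with $d_i=\sum_js_{ij}^2$; (3) $\sqrt{d_j}\,s_{ij}=\sqrt{d_i}\,s_{ji}$ for all $i,j$; (4) $\sum_l s_{li}s_{lj}s_{lk}d_l^{-1}\in\mathbb{Z}$ for all $i,j,k$. Such an $s$ is an Allen matrix, with Fourier matrix $S_{ij}=s_{ij}/\sqrt{d_i}$. *)

(* Defs.v *)
From HB Require Import structures.
From mathcomp Require Import all_boot all_order all_algebra all_field.
From mathcomp Require Import ring.

Set Implicit Arguments.
Unset Strict Implicit.
Unset Printing Implicit Defensive.

Import Order.TTheory GRing.Theory Num.Theory.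
Local Open Scope ring_scope.

(* Columns of length r = n.+1 with entrywise operations. This is a copy of
   'cV_r because matrices with n = 0 already carry the ring structure of
   square matrices. *)
Definition colalg (C : fieldType) (n : nat) : Type := 'cV[C]_n.+1.

Section ColAlg.
Variables (C : fieldType) (n : nat).
Notation T := (colalg C n).

HB.instance Definition _ := Vector.copy T 'cV[C]_n.+1.

Definition colmul (u v : T) : T := \col_i (u i 0 * v i 0).
Definition colone : T := const_mx 1.

Fact colmulA : associative colmul.
Proof. by move=> u v w; apply/colP=> i; rewrite !mxE mulrA. Qed.
Fact colmulC : commutative colmul.
Proof. by move=> u v; apply/colP=> i; rewrite !mxE mulrC. Qed.
Fact colmul1 : left_id colone colmul.
Proof. by move=> u; apply/colP=> i; rewrite !mxE mul1r. Qed.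
Fact colmulDl : left_distributive colmul +%R.
Proof. by move=> u v w; apply/colP=> i; rewrite !mxE mulrDl. Qed.
Fact colone_neq0 : colone != 0.
Proof. by apply/eqP=> /colP/(_ 0)/eqP; rewrite !mxE oner_eq0. Qed.

HB.instance Definition _ := GRing.Zmodule_isComNzRing.Build T
  colmulA colmulC colmul1 colmulDl colone_neq0.

Fact colscaleAl (a : C) (u v : T) : a *: (u * v) = (a *: u) * v.
Proof. by apply/colP=> i; rewrite !mxE mulrA. Qed.
HB.instance Definition _ := GRing.Lmodule_isLalgebra.Build C T colscaleAl.
Fact colscaleAr (a : C) (u v : T) : a *: (u * v) = u * (a *: v).
Proof. by rewrite mulrC colscaleAl mulrC. Qed.
HB.instance Definition _ := GRing.Lalgebra_isAlgebra.Build C T colscaleAr.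
HB.instance Definition _ := Algebra_isFalgebra.Build C T.

End ColAlg.

Section Fourier.
Variable C : numClosedFieldType.

Definition is_int (x : C) : Prop := exists m : int, x = m%:~R.

Definition Fourier_matrix n (S : 'M[C]_n.+1) : Prop :=
  [/\ S \is unitarymx, S^T = S, forall i, 0 < S i 0
    & forall i j k,
        is_int (\sum_l S l i * S l j * (S l k)^* * (S l 0)^-1)].

Definition Allen_matrix n (s : 'M[C]_n.+1) : Prop :=
  exists2 S : 'M[C]_n.+1, Fourier_matrix S &
    s = \matrix_(i, j) (S i j / S i 0).

(* (A, B, delta) is the triple determined by s: the basis vectors are the
   columns of P = [s_ij s_0j], A is their span as a subalgebra of the
   entrywise algebra, and delta reads off the 0-th coordinate. *)
Definition C_algebra_from n (s : 'M[C]_n.+1) (A : {aspace colalg C n})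
    (B : 'I_n.+1 -> subvs_of A) (delta : {lrmorphism subvs_of A -> C^o})
    : Prop :=
  [/\ forall i j, (vsval (B j) : 'cV[C]_n.+1) i 0 = s i j * s 0 j,
      (A : {vspace colalg C n}) = <<[seq vsval (B j) | j : 'I_n.+1]>>%VS
    & forall a, delta a = (vsval a : 'cV[C]_n.+1) 0 0].

Definition homogeneous n (A : {aspace colalg C n})
    (B : 'I_n.+1 -> subvs_of A) (delta : {lrmorphism subvs_of A -> C^o})
    : Prop :=
  exists2 k : nat, (0 < k)%N & forall i, i != 0 -> delta (B i) = k%:R.

Definition sqrnorm_row n (s : 'M[C]_n.+1) (i : 'I_n.+1) : C :=
  \sum_j s i j ^+ 2.

Definition integral_Fourier_matrix n (s : 'M[C]_n.+1) : Prop :=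
  [/\ forall i j, is_int (s i j),
      (forall i, s i 0 = 1) /\ \det s != 0,
      s *m s^T = diag_mx (\row_i sqrnorm_row s i),
      forall i j, sqrtC (sqrnorm_row s j) * s i j = sqrtC (sqrnorm_row s i) * s j i
    & forall i j k, is_int (\sum_l s l i * s l j * s l k * (sqrnorm_row s l)^-1)].

Section FullDegree.
Variable n : nat.
Let aT : falgType C := colalg C n.

Definition full_degree (a : subvs_of {:aT}%AS) : C^o :=
  (vsval a : 'cV[C]_n.+1) 0 0.

Fact full_degree_linear : linear full_degree.
Proof. by move=> k u v; rewrite /full_degree !mxE. Qed.
Fact full_degree_monoid : monoid_morphism full_degree.
Proof.
split; last by move=> u v; rewrite /full_degree mxE.
rewrite /full_degree; have -> : vsval (1 : subvs_of {:aT}%AS) = 1 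
  by apply/eqP; rewrite (algid_eq1 {:aT}%AS) memvf.
by rewrite mxE.
Qed.

HB.instance Definition _ :=
  GRing.isLinear.Build C _ C^o _ full_degree full_degree_linear.
HB.instance Definition _ :=
  GRing.isMonoidMorphism.Build _ C^o full_degree full_degree_monoid.

End FullDegree.

(* C_algebra_from is relational; for an Allen matrix P is invertible, so the
   span is the whole entrywise algebra and the triple exists. *)
Lemma C_algebra_exists n (s : 'M[C]_n.+1) : Allen_matrix s ->
  exists (A : {aspace colalg C n}) (B : 'I_n.+1 -> subvs_of A)
    (delta : {lrmorphism subvs_of A -> C^o}), C_algebra_from s B delta.
Proof.
case=> S [Su Ssym Spos _] defs.
have S0 i : S i 0 != 0 by rewrite gt_eqF.
have sE i j : s i j = S i j / S i 0 by rewrite defs mxE.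
pose P : 'M[C]_n.+1 := \matrix_(i, j) (s i j * s 0 j).
have s0 j : s 0 j != 0.
  by rewrite sE mulf_neq0 ?invr_eq0 // -Ssym mxE.
have Pu : P \in unitmx.
  have ->: P = diag_mx (\row_i (S i 0)^-1) *m S *m diag_mx (\row_j s 0 j).
    apply/matrixP=> i j; rewrite mul_mx_diag mul_diag_mx !mxE sE.
    by rewrite [_^-1 * _]mulrC.
  rewrite !unitmx_mul (unitarymx_unit Su) andbT !unitmxE !det_diag !unitfE.
  by apply/andP; split; apply/prodf_neq0 => i _; rewrite mxE ?invr_eq0.
exists {:colalg C n}%AS, (fun j => vsproj _ (col j P : colalg C n)).
exists (@full_degree n); split=> [i j||//].
  by rewrite vsprojK ?memvf // !mxE.
apply/esym/eqP; rewrite eqEsubv subvf /=; apply/subvP=> v _.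
have ->: v = \sum_j (invmx P *m (v : 'cV[C]_n.+1)) j 0 *:
               (col j P : colalg C n).
  rewrite -{1}[v : 'cV_n.+1](mulKVmx Pu); apply/colP=> i.
  by rewrite mxE summxE; apply: eq_bigr => j _; rewrite !mxE mulrC.
apply: memv_suml => j _; apply: memvZ; apply: memv_span.
by apply/imageP; exists j; rewrite ?vsprojK ?memvf.
Qed.

Lemma integral_Fourier_Allen n (s : 'M[C]_n.+1) :
  integral_Fourier_matrix s -> Allen_matrix s.
Proof.
case=> sZ [s0 _] sO sS sN.
have sR i j : (s i j)^* = s i j.
  by have [m ->] := sZ i j; rewrite rmorph_int.
have d_gt0 i : 0 < sqrnorm_row s i.
  rewrite /sqrnorm_row (bigD1 0) //= s0 expr1n ltr_wpDr ?ltr01 //.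
  by apply: sumr_ge0 => j _; have [m ->] := sZ i j; rewrite -rmorphXn ler0z
    sqr_ge0.
pose q i := sqrtC (sqrnorm_row s i).
have q_gt0 i : 0 < q i by rewrite sqrtC_gt0.
have q0 i : q i != 0 by rewrite gt_eqF.
have qK i : q i * q i = sqrnorm_row s i by rewrite -expr2 sqrtCK.
have qR i : (q i)^* = q i by rewrite conj_Creal // ger0_real // ltW.
pose S : 'M[C]_n.+1 := \matrix_(i, j) (s i j / q i).
exists S; last first.
  by apply/matrixP=> i j; rewrite !mxE s0 div1r invrK divfK.
split.
- apply/unitarymxP/matrixP=> i k.
  have /matrixP/(_ i k) := sO; rewrite !mxE => sOik.
  transitivity ((\sum_j s i j * s^T j k) / (q i * q k)).
    rewrite mulr_suml; apply: eq_bigr => j _.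
    by rewrite !mxE rmorphM fmorphV /= sR qR invfM mulrACA.
  rewrite sOik; case: eqVneq => [->|_]; last by rewrite mulr0n mul0r.
  by rewrite qK mulr1n divff // gt_eqF.
- apply/matrixP=> i j; rewrite !mxE; apply/eqP.
  by rewrite eqr_div // [_ * q i]mulrC [_ * q j]mulrC -/(q _) sS.
- by move=> i; rewrite mxE s0 div1r invr_gt0.
move=> i j k; have [m defm] := sN i j k; exists m; rewrite -defm.
apply: eq_bigr => l _; rewrite !mxE rmorphM fmorphV /= sR qR s0 div1r invrK.
rewrite -qK; have ql0 := q0 l; by field.
Qed.

End Fourier.

(* Main.v *)
(* Put D = d_0 and m_i = s_{0i}.  Squaring (3) for j = 0 gives d_i m_i^2 = D,
   and det(s)^2 = d_0 ... d_{r-1} gives (det(s) m_0 ... m_{r-1})^2 = D^r.  For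
   odd r this makes D a square N^2, so each m_i divides N and the integers
   N / m_i have inverse squares summing to 1.  This is impossible for r = 5:
   all are at least 2, four values 2 already use up the sum, and with at most
   three of them it is at most 3/4 + 2/9 < 1. *)
Require Import Defs.
From mathcomp Require Import all_boot all_order all_algebra all_field.
From mathcomp Require Import reals complex.
From mathcomp Require Import zify.

Import GRing.Theory Num.Theory.
Local Open Scope ring_scope.

(** Since [D ^ k.*2] divides [x ^ 2], [D ^ k] divides [x], and the quotient has square [D]. *)
Lemma sqr_of_sqr_eq_odd_exp (D x k : nat) :
  (0 < D)%N -> (x ^ 2 = D ^ k.*2.+1)%N -> exists N, (N ^ 2 = D)%N.
Proof.
move=> D_gt0 def_x2.
have /dvdnP[N def_x] : (D ^ k %| x)%N.
  by rewrite -(dvdn_pexp2r _ _ (isT : (0 < 2)%N)) def_x2 -expnM muln2 expnS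
    dvdn_mull.
exists N; apply/eqP; rewrite -(eqn_pmul2r (_ : 0 < D ^ k.*2)%N) ?expn_gt0 ?D_gt0 //.
by rewrite -expnS -def_x2 def_x expnMn -(expnM D) muln2.
Qed.

Lemma sqr_neq_sum5_sqr_dvd (N : nat) (m : 'I_5 -> nat) :
  (forall i, (0 < m i)%N) -> (forall i, (m i %| N)%N) ->
  (N ^ 2 <> \sum_i m i ^ 2)%N.
Proof.
move=> m_gt0 m_dvd def_N2.
have N2_gt i : (m i ^ 2 < N ^ 2)%N.
  rewrite def_N2 (bigD1 i) //= -[X in (X < _)%N]addn0 ltn_add2l.
  (* Strictness comes from a second index, whose square is positive. *)
  have [j ji] : exists j : 'I_5, j != i.
    by case: (eqVneq i ord0) => [->|]; [exists ord_max | exists ord0; rewrite eq_sym].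
  by rewrite (bigD1 j) //= ltn_addr // expn_gt0 m_gt0.
have m_cases i : (4 * m i ^ 2 = N ^ 2)%N \/ (9 * m i ^ 2 <= N ^ 2)%N.
  have := N2_gt i; have /dvdnP[e ->] := m_dvd i; rewrite expnMn.
  (* With [N = e * m i], the cases e = 0, 1 contradict [N2_gt], e = 2 gives the equality, and e >= 3
     the bound. *)
  case: e => [|[|[|e]]]; rewrite ?mul1n ?ltnn // => _; first by left.
  by right; rewrite leq_mul2r (leq_exp2r 3 e.+3 (isT : (0 < 2)%N)) // orbT.
have m2_gt0 i : (0 < m i ^ 2)%N by rewrite expn_gt0 m_gt0.
have := def_N2; rewrite !big_ord_recl big_ord0.
(* Once the squares are generalized the problem is linear; their positivity excludes four
   equalities. *)
do ![match goal with |- context [(m ?i ^ 2)%N] =>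
  move: (m_cases i) (m2_gt0 i); move: (m i ^ 2)%N => ? end].
lia.
Qed.

Lemma sqr_intr_absz (R : numDomainType) (x : int) :
  x%:~R ^+ 2 = (`|x| ^ 2)%N%:R :> R.
Proof. by rewrite -rmorphXn /= -abszX natr_absz ger0_norm ?sqr_ge0. Qed.

Section IntegralFourierMatrix.
Variables (C : numClosedFieldType) (n : nat) (s : 'M[C]_n.+1).
Hypothesis s_iFm : integral_Fourier_matrix s.

Lemma sqrnorm_row_mul_sqr i : sqrnorm_row s i * s 0 i ^+ 2 = sqrnorm_row s 0.
Proof.
case: s_iFm => _ [s0 _] _ sS _.
have /(congr1 (fun x => x ^+ 2)) := sS i 0.
by rewrite !exprMn !sqrtCK s0 expr1n mulr1.
Qed.

Lemma det_sqr_prod_sqrnorm_row : \det s ^+ 2 = \prod_i sqrnorm_row s i.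
Proof.
case: s_iFm => _ _ sO _ _.
rewrite expr2 -{2}det_tr -det_mulmx sO det_diag.
by apply: eq_bigr => i _; rewrite mxE.
Qed.

(** The rank is [n.+1], so even [n] means odd rank. *)
Lemma odd_rank_sqr_eq_sum_sqr_dvd : ~~ odd n ->
  exists (N : nat) (m : 'I_n.+1 -> nat),
    [/\ forall i, (0 < m i)%N, forall i, (m i %| N)%N
      & (N ^ 2 = \sum_i m i ^ 2)%N].
Proof.
move=> n_even; have [sZ [s0 _] _ _ _] := s_iFm.
have s_rowZ i : exists u : 'I_n.+1 -> int, forall j, s i j = (u j)%:~R.
  exact: fin_all_exists (sZ i).
have [t sE] := fin_all_exists s_rowZ.
pose m (i : 'I_n.+1) := `|t ord0 i|%N.
pose d (i : 'I_n.+1) := (\sum_j `|t i j| ^ 2)%N.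
have sqrE i j : s i j ^+ 2 = (`|t i j| ^ 2)%N%:R.
  by rewrite sE sqr_intr_absz.
have dE i : sqrnorm_row s i = (d i)%:R.
  by rewrite /d natr_sum; apply: eq_bigr => j _; rewrite sqrE.
have dm i : (d i * m i ^ 2 = d ord0)%N.
  by apply/eqP; rewrite -(eqr_nat C) natrM -sqrE -!dE sqrnorm_row_mul_sqr.
have d_gt0 : (0 < d ord0)%N.
  rewrite /d (bigD1 ord0) //= ltn_addr //.
  by rewrite -(ltr_nat C) -sqrE s0 expr1n ltr01.
have m_gt0 i : (0 < m i)%N.
  by have := d_gt0; rewrite -(dm i) muln_gt0 expn_gt0 orbF => /andP[].
have det_sE : \det s = (\det (\matrix_(i, j) t i j))%:~R.
  rewrite -det_map_mx; congr (\det _).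
  by apply/matrixP=> i j; rewrite !mxE sE.
pose x := (`|\det (\matrix_(i, j) t i j)| * \prod_i m i)%N.
(* Pairing each [d i] with [m i ^ 2] makes [x ^ 2] a product of [n.+1] factors [d ord0]. *)
have x2 : (x ^ 2 = d ord0 ^ n./2.*2.+1)%N.
  apply/eqP; rewrite -(eqr_nat C) /x expnMn natrM -sqr_intr_absz -det_sE.
  rewrite det_sqr_prod_sqrnorm_row (eq_bigr _ (fun i _ => dE i)) -natr_prod.
  rewrite -natrM eqr_nat -mulnn -!big_split /=.
  rewrite (eq_bigr _ (fun i _ => dm i)) prod_nat_const card_ord.
  by have := odd_double_half n; rewrite (negPf n_even) add0n => ->.
have [N N2] := sqr_of_sqr_eq_odd_exp _ _ _ d_gt0 x2.
(* The sum formula is [N2], as [d ord0] unfolds to the sum of the [m i ^ 2]; divisibility follows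
   from that of the squares, by [dm]. *)
exists N, m; split=> // i.
by rewrite -(dvdn_pexp2r _ _ (isT : (0 < 2)%N)) N2 -(dm i) dvdn_mull.
Qed.

End IntegralFourierMatrix.

Lemma not_integral_Fourier_matrix5 (C : numClosedFieldType) (s : 'M[C]_5) :
  ~ integral_Fourier_matrix s.
Proof.
move=> s_iFm.
have [N [m [m_gt0 m_dvd]]] := odd_rank_sqr_eq_sum_sqr_dvd _ _ _ s_iFm isT.
exact: sqr_neq_sum5_sqr_dvd.
Qed.

Theorem theorem38 (R : realType) :
  (forall (s : 'M[R[i]]_5) (A : {aspace colalg R[i] 4})
     (B : 'I_5 -> subvs_of A) (delta : {lrmorphism subvs_of A -> R[i]^o}),
     Allen_matrix s -> C_algebra_from s B delta -> ~ homogeneous B delta ->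
     ~ integral_Fourier_matrix s) /\
  ~ (exists (s : 'M[R[i]]_5) (A : {aspace colalg R[i] 4})
       (B : 'I_5 -> subvs_of A) (delta : {lrmorphism subvs_of A -> R[i]^o}),
       integral_Fourier_matrix s /\ C_algebra_from s B delta).
Proof.
split=> [s A B delta _ _ _|[s [A [B [delta [s_iFm _]]]]]].
  exact: not_integral_Fourier_matrix5.
exact: not_integral_Fourier_matrix5 s_iFm.
Qed.
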